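(* Given $d\in\mathrm{PP}_n$, where $\mathrm{PP}_n\subseteq\mathbb{R}^n$ is the parity polytope, it is possible to construct a matrix $X\in\mathrm{SO}(n)$ satisfying $\operatorname{diag}(X)=d$ in time $O(n^2)$.
   Context: $\mathrm{SO}(n)=\{X\in\mathbb{R}^{n\times n}: X^\intercal X=I,\ \det(X)=1\}$. The parity polytope is $\mathrm{PP}_n=\operatorname{conv}\{x\in\{\pm1\}^n:\ \prod_{i=1}^n x_i=1\}$. The map $\operatorname{diag}:\mathbb{R}^{n\times n}\to\mathbb{R}^n$ sends a matrix to the vector of its diagonal entries. Running time counts basic arithmetic operations on real numbers, including square roots, which are assumed to be performed exactly. *)

(* Defs.v *)
From HB Require Import structures.
From mathcomp Require Import all_boot all_order all_algebra.
From mathcomp Require Import classical_sets reals.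

Set Implicit Arguments.
Unset Strict Implicit.
Unset Printing Implicit Defensive.

Import Order.TTheory GRing.Theory Num.Theory.

Local Open Scope classical_set_scope.
Local Open Scope ring_scope.

Definition special_orthogonal (R : realType) (n : nat) : set 'M[R]_n :=
  [set X | X^T *m X = 1%:M /\ \det X = 1].

Definition conv_hull (R : realType) (n : nat) (S : set 'rV[R]_n) : set 'rV[R]_n :=
  [set x | exists (k : nat) (w : 'I_k -> R) (v : 'I_k -> 'rV[R]_n),
     [/\ forall i, 0 <= w i,
         \sum_(i < k) w i = 1,
         forall i, S (v i) &
         x = \sum_(i < k) w i *: v i]].

Definition parity_polytope (R : realType) (n : nat) : set 'rV[R]_n :=
  conv_hull [set x : 'rV[R]_n | (forall i, x 0 i = 1 \/ x 0 i = -1) /\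
                                \prod_(i < n) x 0 i = 1].

(* [diag_mx] goes the other way, from vectors to diagonal matrices. *)
Definition diag_vec (R : realType) (n : nat) (X : 'M[R]_n) : 'rV[R]_n :=
  \row_i X i i.

(* The model of computation is a real RAM, presented as a while language.  A
   single finite program serves all dimensions.  There are index registers
   holding natural numbers, and arrays of real cells addressed by two index
   expressions.  A real value can be inspected only through comparisons, there
   is no rounding to an index and no conversion of indices into reals, and the
   only real literals are 0 and 1. *)

Inductive iexp :=
  | IVar of nat
  | ICst of nat
  | IAdd of iexp & iexp
  | ISub of iexp & iexp.

Inductive rexp :=
  | RZero
  | ROne
  | RCell of nat & iexp & iexp  (* RCell a i j is entry (i, j) of array a *)
  | RAdd of rexp & rexp
  | RSub of rexp & rexp
  | RMul of rexp & rexp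
  | RDiv of rexp & rexp
  | RSqrt of rexp.

Inductive bexp :=
  | ILt of iexp & iexp
  | RLe of rexp & rexp.

Inductive com :=
  | Skip
  | ISet of nat & iexp
  | RSet of nat & iexp & iexp & rexp  (* RSet a i j e assigns e to entry (i, j) of array a *)
  | Seq of com & com
  | If of bexp & com & com
  | While of bexp & com.

Record state (R : realType) := State {
  idx : nat -> nat;
  cell : nat -> nat -> nat -> R
}.

Fixpoint ieval (r : nat -> nat) (e : iexp) : nat :=
  match e with
  | IVar x => r x
  | ICst c => c
  | IAdd e1 e2 => (ieval r e1 + ieval r e2)%N
  | ISub e1 e2 => (ieval r e1 - ieval r e2)%N
  end.

(* Division by zero and square roots of negative numbers are errors (None),
   in contrast with the total operations of the library. *)
Fixpoint reval (R : realType) (s : state R) (e : rexp) : option R :=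
  match e with
  | RZero => Some 0
  | ROne => Some 1
  | RCell a i j => Some (cell s a (ieval (idx s) i) (ieval (idx s) j))
  | RAdd e1 e2 =>
      if (reval s e1, reval s e2) is (Some x, Some y) then Some (x + y) else None
  | RSub e1 e2 =>
      if (reval s e1, reval s e2) is (Some x, Some y) then Some (x - y) else None
  | RMul e1 e2 =>
      if (reval s e1, reval s e2) is (Some x, Some y) then Some (x * y) else None
  | RDiv e1 e2 =>
      if (reval s e1, reval s e2) is (Some x, Some y)
      then if y == 0 then None else Some (x / y) else None
  | RSqrt e1 =>
      if reval s e1 is Some x
      then if 0 <= x then Some (Num.sqrt x) else None else None
  end.

Definition beval (R : realType) (s : state R) (b : bexp) : option bool :=
  match b with
  | ILt e1 e2 => Some (ieval (idx s) e1 < ieval (idx s) e2)%N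
  | RLe e1 e2 =>
      if (reval s e1, reval s e2) is (Some x, Some y) then Some (x <= y) else None
  end.

(* Unit cost for every operation and every memory access, index arithmetic
   and comparisons included. *)

Fixpoint icost (e : iexp) : nat :=
  match e with
  | IVar _ | ICst _ => 1
  | IAdd e1 e2 | ISub e1 e2 => (icost e1 + icost e2).+1
  end.

Fixpoint rcost (e : rexp) : nat :=
  match e with
  | RZero | ROne => 1
  | RCell _ i j => (icost i + icost j).+1
  | RAdd e1 e2 | RSub e1 e2 | RMul e1 e2 | RDiv e1 e2 => (rcost e1 + rcost e2).+1
  | RSqrt e1 => (rcost e1).+1
  end.

Definition bcost (b : bexp) : nat :=
  match b with
  | ILt e1 e2 => (icost e1 + icost e2).+1
  | RLe e1 e2 => (rcost e1 + rcost e2).+1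
  end.

Definition set_idx (R : realType) (s : state R) (x v : nat) : state R :=
  State (fun y => if y == x then v else idx s y) (cell s).

Definition set_cell (R : realType) (s : state R) (a i j : nat) (v : R) : state R :=
  State (idx s)
    (fun b k l => if [&& b == a, k == i & l == j] then v else cell s b k l).

(* exec c s t s': started in s, the command c halts without error in s' after
   t time units. *)
Inductive exec (R : realType) : com -> state R -> nat -> state R -> Prop :=
  | ExecSkip s :
      exec Skip s 1 s
  | ExecISet s x e :
      exec (ISet x e) s (icost e).+1 (set_idx s x (ieval (idx s) e))
  | ExecRSet s a i j e v :
      reval s e = Some v ->
      exec (RSet a i j e) s (icost i + icost j + rcost e).+1
        (set_cell s a (ieval (idx s) i) (ieval (idx s) j) v)
  | ExecSeq c1 c2 s1 s2 s3 t1 t2 :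
      exec c1 s1 t1 s2 -> exec c2 s2 t2 s3 ->
      exec (Seq c1 c2) s1 (t1 + t2) s3
  | ExecIf b c1 c2 s s' t v :
      beval s b = Some v -> exec (if v then c1 else c2) s t s' ->
      exec (If b c1 c2) s (bcost b + t).+1 s'
  | ExecWhileFalse b c s :
      beval s b = Some false ->
      exec (While b c) s (bcost b).+1 s
  | ExecWhileTrue b c s1 s2 s3 t1 t2 :
      beval s1 b = Some true ->
      exec c s1 t1 s2 -> exec (While b c) s2 t2 s3 ->
      exec (While b c) s1 (bcost b + t1 + t2).+1 s3.

(* Hence the existence of one halting run is the same as total correctness. *)
Lemma exec_det (R : realType) (c : com) (s : state R) (t1 t2 : nat) (s1 s2 : state R) :
  exec c s t1 s1 -> exec c s t2 s2 -> t1 = t2 /\ s1 = s2.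
Proof.
move=> E1; elim: E1 t2 s2 => {c s t1 s1}.
- by move=> s t2 s2 E; inversion E.
- by move=> s x e t2 s2 E; inversion E.
- move=> s a i j e v ev t2 s2 E; inversion E as [| | ? ? ? ? ? v' ev' | | | |]; subst.
  by move: ev'; rewrite ev => -[->].
- move=> c1 c2 s1 s2 s3 t1 t2 _ IH1 _ IH2 t s E.
  inversion E as [| | | ? ? ? ? ? ? ? E1 E2 | | |]; subst.
  by have [? ?] := IH1 _ _ E1; subst; have [? ?] := IH2 _ _ E2; subst.
- move=> b c1 c2 s s' t v bv _ IH t2 s2 E.
  inversion E as [| | | | ? ? ? ? ? ? v' bv' E' | |]; subst.
  by move: bv'; rewrite bv => -[?]; subst; have [? ?] := IH _ _ E'; subst.
- move=> b c s bv t2 s2 E.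
  inversion E as [| | | | | | ? ? ? ? ? ? ? bv']; subst => //.
  by move: bv'; rewrite bv.
- move=> b c s1 s2 s3 t1 t2 bv _ IH1 _ IH2 t s E.
  inversion E as [| | | | | ? ? ? bv' | ? ? ? ? ? ? ? bv' E1 E2]; subst.
    by move: bv'; rewrite bv.
  by have [? ?] := IH1 _ _ E1; subst; have [? ?] := IH2 _ _ E2; subst.
Qed.

(* The input: n in register 0, d in column 0 of array 0, and 0 elsewhere. *)
Definition init (R : realType) (n : nat) (d : 'rV[R]_n) : state R :=
  State (fun x => if x == 0%N then n else 0%N)
    (fun a i j =>
       if (a == 0%N) && (j == 0%N)
       then if insub i is Some k then d 0 k else 0
       else 0).

(* The output is read from array 1. *)
Definition output (R : realType) (n : nat) (s : state R) : 'M[R]_n :=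
  \matrix_(i < n, j < n) cell s 1%N i j.

(* Main.v *)
(* The sign vectors of product -1 are at l1-distance at least 2 from every point d
   of the parity polytope. This consequence of membership is all that is used; the
   distances from the suffixes of d to the odd and to the even sign vectors are
   computed by dynamic programming in linear time.

   The matrix is built by induction on n. With a = d_1 and b = d_2, let
   x = max(|a + b| - 1, 1 - e), where e is the distance from (d_3, ..., d_n) to the
   even sign vectors. Then (x, d_3, ..., d_n) is again at distance at least 2 from
   the odd ones, hence it is the diagonal of some X' in SO(n-1), while
   |a + b| <= 1 + x and |a - b| <= 1 - x. The latter two inequalities yield plane
   rotations G and H such that G diag(1, x) H^T has diagonal (a, b); applied to the
   first two rows and columns of 1 (+) X', they produce the required matrix. Their
   entries are obtained from half-angle formulas with square roots. Each of the
   n - 1 steps changes two rows and two columns, hence takes time O(n). *)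
Require Import Defs.
From mathcomp Require Import all_boot all_order all_algebra.
From mathcomp Require Import classical_sets reals.
From mathcomp Require Import zify ring lra.

Set Implicit Arguments.
Unset Strict Implicit.
Unset Printing Implicit Defensive.

Import Order.TTheory GRing.Theory Num.Theory.

Local Open Scope ring_scope.

(** * Total correctness with a time bound for the while language *)

Definition runs (R : realType) (c : com) (s : state R) (T : nat)
    (Q : state R -> Prop) : Prop :=
  exists t s', [/\ exec c s t s', (t <= T)%N & Q s'].

Section Runs.
Context {R : realType}.
Implicit Types (s : state R) (Q : state R -> Prop).

Lemma runs_weaken c s T T' Q Q' :
  (T <= T')%N -> (forall s', Q s' -> Q' s') -> runs c s T Q -> runs c s T' Q'.
Proof.
move=> leT QQ' [t [s' [E le_t Qs']]]; exists t, s'; split => //.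
  exact: leq_trans leT.
exact: QQ'.
Qed.

Lemma runs_le c s T T' Q : (T <= T')%N -> runs c s T Q -> runs c s T' Q.
Proof. by move=> leT; apply: runs_weaken. Qed.

Lemma runs_iset x e s Q :
  Q (set_idx s x (ieval (idx s) e)) -> runs (ISet x e) s (icost e).+1 Q.
Proof. by move=> Qs; do 2!eexists; split; [exact: ExecISet | |]. Qed.

Lemma runs_rset a i j e v s Q :
  reval s e = Some v ->
  Q (set_cell s a (ieval (idx s) i) (ieval (idx s) j) v) ->
  runs (RSet a i j e) s (icost i + icost j + rcost e).+1 Q.
Proof. by move=> ev Qs; do 2!eexists; split; [exact: (ExecRSet _ _ _ ev) | |]. Qed.

(** The run of [c2] is the postcondition of [c1], so rules chain without explicit intermediate
    assertions. *)
Lemma runs_seq c1 c2 s T1 T2 Q :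
  runs c1 s T1 (fun s' => runs c2 s' T2 Q) -> runs (Seq c1 c2) s (T1 + T2) Q.
Proof.
move=> [t1 [s1 [E1 le1 [t2 [s2 [E2 le2 Qs]]]]]].
by exists (t1 + t2)%N, s2; split; [exact: ExecSeq E1 E2 | exact: leq_add |].
Qed.

Lemma runs_if b c1 c2 s T1 T2 Q v :
  beval s b = Some v ->
  (v -> runs c1 s T1 Q) -> (~~ v -> runs c2 s T2 Q) ->
  runs (If b c1 c2) s (bcost b + maxn T1 T2).+1 Q.
Proof.
move=> bv H1 H2.
have [t [s' [E le_t Qs]]] : runs (if v then c1 else c2) s (maxn T1 T2) Q.
  case: v bv H1 H2 => _ H1 H2.
    by apply: runs_weaken (H1 isT) => //; rewrite leq_maxl.
  by apply: runs_weaken (H2 isT) => //; rewrite leq_maxr.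
exists (bcost b + t).+1, s'; split => //; first exact: ExecIf bv E.
by rewrite ltnS leq_add2l.
Qed.

(** The index of the invariant [I] is the exact number of iterations left: it yields termination and
    the iteration count at once. *)
Lemma runs_while b c (I : nat -> state R -> Prop) T m s :
  (forall m s, I m.+1 s -> beval s b = Some true /\ runs c s T (I m)) ->
  (forall s, I 0%N s -> beval s b = Some false) ->
  I m s ->
  runs (While b c) s (m * (bcost b + T).+1 + (bcost b).+1) (I 0%N).
Proof.
move=> body stop; elim: m s => [|m IH] s Is.
  by exists (bcost b).+1, s; split => //; exact: ExecWhileFalse (stop _ Is).
have [bt [t1 [s1 [E1 le1 Is1]]]] := body _ _ Is.
have [t2 [s2 [E2 le2 Is2]]] := IH _ Is1.
exists (bcost b + t1 + t2).+1, s2; split => //; first exact: ExecWhileTrue bt E1 E2.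
by lia.
Qed.

Definition set_min a i j e1 e2 := If (RLe e1 e2) (RSet a i j e1) (RSet a i j e2).
Definition set_max a i j e1 e2 := If (RLe e1 e2) (RSet a i j e2) (RSet a i j e1).

Definition opt_cost i j e1 e2 :=
  (bcost (RLe e1 e2) + maxn (icost i + icost j + rcost e1).+1
                            (icost i + icost j + rcost e2).+1).+1.

Lemma runs_min a i j e1 e2 v1 v2 s Q :
  reval s e1 = Some v1 -> reval s e2 = Some v2 ->
  Q (set_cell s a (ieval (idx s) i) (ieval (idx s) j) (Num.min v1 v2)) ->
  runs (set_min a i j e1 e2) s (opt_cost i j e1 e2) Q.
Proof.
move=> ev1 ev2 Qs; apply: (runs_if (v := v1 <= v2)); first by rewrite /= ev1 ev2.
  by move=> le12; apply: (runs_rset ev1); move: Qs; rewrite min_l.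
by rewrite -ltNge => /ltW le21; apply: (runs_rset ev2); move: Qs; rewrite min_r.
Qed.

Lemma runs_max a i j e1 e2 v1 v2 s Q :
  reval s e1 = Some v1 -> reval s e2 = Some v2 ->
  Q (set_cell s a (ieval (idx s) i) (ieval (idx s) j) (Num.max v1 v2)) ->
  runs (set_max a i j e1 e2) s (opt_cost i j e1 e2) Q.
Proof.
move=> ev1 ev2 Qs; rewrite /opt_cost maxnC; apply: (runs_if (v := v1 <= v2)).
- by rewrite /= ev1 ev2.
- by move=> le12; apply: (runs_rset ev2); move: Qs; rewrite max_r.
- by rewrite -ltNge => /ltW le21; apply: (runs_rset ev1); move: Qs; rewrite max_l.
Qed.

End Runs.

(** * Plane rotations and the special orthogonal group *)

Section Givens.
Context {R : realType} {n : nat}.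
Implicit Types (p q : 'I_n) (c s : R) (A : 'M[R]_n).

Definition givens p q c s : 'M[R]_n :=
  \matrix_(i, j) if i == p then c * (j == p)%:R - s * (j == q)%:R
                 else if i == q then s * (j == p)%:R + c * (j == q)%:R
                 else (j == i)%:R.

Lemma sum_indicator (f : 'I_n -> R) p : \sum_j (j == p)%:R * f j = f p.
Proof.
rewrite (bigD1 p) //= eqxx mul1r big1 ?addr0 // => j /negbTE ->.
by rewrite mul0r.
Qed.

Lemma mul_givensE p q c s A i j :
  (givens p q c s *m A) i j =
    if i == p then c * A p j - s * A q j
    else if i == q then s * A p j + c * A q j else A i j.
Proof.
rewrite mxE; have [->|ip] := eqVneq i p.
  under eq_bigr do rewrite mxE eqxx mulrBl -!mulrA.
  by rewrite sumrB -!mulr_sumr !sum_indicator.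
have [iq|iq] := eqVneq i q; last first.
  under eq_bigr do rewrite mxE (negbTE ip) (negbTE iq).
  exact: sum_indicator.
rewrite iq in ip *.
under eq_bigr do rewrite mxE (negbTE ip) eqxx mulrDl -!mulrA.
by rewrite big_split -!mulr_sumr !sum_indicator.
Qed.

Lemma mul_tr_givensE p q c s A i j :
  (A *m (givens p q c s)^T) i j =
    if j == p then c * A i p - s * A i q
    else if j == q then s * A i p + c * A i q else A i j.
Proof.
by rewrite -[A in LHS]trmxK -trmx_mul mxE mul_givensE !mxE.
Qed.

(** The determinant is bilinear and alternating in rows p and q. Expanding both rows over e_p and
    e_q leaves c^2 det(e_p, e_q) - s^2 det(e_q, e_p), and the second determinant is -1 because the
    determinant vanishes when both rows are e_p + e_q. *)
Lemma det_givens p q c s :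
  p != q -> c ^+ 2 + s ^+ 2 = 1 -> \det (givens p q c s) = 1.
Proof.
move=> pq cs1.
pose rows (u v : 'rV[R]_n) : 'M[R]_n :=
  \matrix_(i, j) if i == p then u 0 j else if i == q then v 0 j else (j == i)%:R.
pose e i : 'rV[R]_n := delta_mx 0 i.
have row_p u v : row p (rows u v) = u by apply/rowP => j; rewrite !mxE eqxx.
have row_q u v : row q (rows u v) = v.
  by apply/rowP => j; rewrite !mxE eq_sym (negbTE pq) eqxx.
have detDp b1 u1 b2 u2 v : \det (rows (b1 *: u1 + b2 *: u2) v) =
    b1 * \det (rows u1 v) + b2 * \det (rows u2 v).
  apply: (determinant_multilinear (i0 := p)); first by rewrite !row_p.
    by apply/matrixP => i j; rewrite !mxE [lift _ _ == p]eq_sym (negbTE (neq_lift _ _)).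
  by apply/matrixP => i j; rewrite !mxE [lift _ _ == p]eq_sym (negbTE (neq_lift _ _)).
have detDq b1 v1 b2 v2 u : \det (rows u (b1 *: v1 + b2 *: v2)) =
    b1 * \det (rows u v1) + b2 * \det (rows u v2).
  apply: (determinant_multilinear (i0 := q)); first by rewrite !row_q.
    by apply/matrixP => i j; rewrite !mxE [lift _ _ == q]eq_sym (negbTE (neq_lift _ _)).
  by apply/matrixP => i j; rewrite !mxE [lift _ _ == q]eq_sym (negbTE (neq_lift _ _)).
have det_eq u : \det (rows u u) = 0.
  apply: (determinant_alternate pq) => j.
  by rewrite !mxE eqxx eq_sym (negbTE pq) eqxx.
have det_id : \det (rows (e p) (e q)) = 1.
  rewrite -[RHS](det1 R n); congr (\det _); apply/matrixP => i j.
  rewrite !mxE [i == j]eq_sym; have [->|_] := eqVneq i p; first by rewrite eqxx.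
  by have [->|_] := eqVneq i q; first by rewrite eqxx.
have det_swap : \det (rows (e q) (e p)) = -1.
  have := det_eq (1 *: e p + 1 *: e q).
  by rewrite detDp !detDq !det_eq det_id; lra.
have -> : givens p q c s = rows (c *: e p + (- s) *: e q) (s *: e p + c *: e q).
  by apply/matrixP => i j; rewrite !mxE mulNr.
rewrite detDp !detDq !det_eq det_id det_swap -[RHS]cs1; ring.
Qed.

Lemma givens_orthogonal p q c s :
  p != q -> c ^+ 2 + s ^+ 2 = 1 -> special_orthogonal (givens p q c s).
Proof.
move=> pq cs1; split; last exact: det_givens.
(* It suffices that G G^T = 1, whose entries [mul_tr_givensE] gives directly. *)
apply: mulmx1C; apply/matrixP => i j.
have qp : (q == p) = false by rewrite eq_sym (negbTE pq).
rewrite mul_tr_givensE !mxE !eqxx qp (negbTE pq).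
have [->|jp] := eqVneq j p.
  have [eip|ip] := eqVneq i p; first by rewrite ?eip -[RHS]cs1 ?qp ?(negbTE pq) /=; ring.
  have [eiq|iq] := eqVneq i q; first by rewrite ?eiq ?qp /=; ring.
  by rewrite /=; ring.
have [->|jq] := eqVneq j q.
  have [eip|ip] := eqVneq i p; first by rewrite ?eip ?(negbTE pq) /=; ring.
  have [eiq|iq] := eqVneq i q; first by rewrite ?eiq -[RHS]cs1 ?qp ?(negbTE pq) /=; ring.
  by rewrite /=; ring.
have [eip|ip] := eqVneq i p; first by rewrite eip eq_sym (negbTE jp) /=; ring.
have [eiq|iq] := eqVneq i q; first by rewrite eiq eq_sym (negbTE jq) /=; ring.
by rewrite eq_sym.
Qed.

Lemma special_orthogonalM A B :
  special_orthogonal A -> special_orthogonal B -> special_orthogonal (A *m B).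
Proof.
move=> [AA dA] [BB dB]; split; last by rewrite det_mulmx dA dB mulr1.
by rewrite trmx_mul mulmxA -[_ *m A^T *m A]mulmxA AA mulmx1.
Qed.

Lemma special_orthogonal_tr A : special_orthogonal A -> special_orthogonal A^T.
Proof.
by move=> [AA dA]; split; [rewrite trmxK; exact: mulmx1C | rewrite det_tr].
Qed.


End Givens.

(** * Distances to the even and odd sign vectors *)

Section ParityDistances.
Context {R : realType}.
Variables (n : nat) (d e o : nat -> R).

(* [e k] and [o k] are the l1-distances from [d k, ..., d (n-1)] to the sign
   vectors of product 1 and -1.  The empty vector has no odd vertex; the value 2
   stands for the infinite distance, since a distance of 2 or more never
   obstructs the construction. *)
Definition parity_distances :=
  [/\ e n = 0, o n = 1 + 1 &
      forall k, (k < n)%N ->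
        e k = Num.min (e k.+1 + (1 - d k)) (o k.+1 + (1 + d k)) /\
        o k = Num.min (o k.+1 + (1 - d k)) (e k.+1 + (1 + d k))].

Hypothesis eoP : parity_distances.
Hypothesis d_le1 : forall k, (k < n)%N -> -1 <= d k <= 1.

(** Sign vectors of opposite parity are at l1-distance at least 2, whence the bound on the sum by
    the triangle inequality. The proof is a descending induction on k: in the sum of the two minima,
    the terms in d k either cancel or are controlled by |d k| <= 1. *)
Lemma parity_distances_ge k :
  (k <= n)%N -> [/\ 0 <= e k, 0 <= o k & 2 <= e k + o k].
Proof.
case: eoP => en on eoS /subKn <-; elim: (n - k)%N (leq_subr k n) => [|m IH] le_m.
  by rewrite subn0 en on; split; lra.
have lt_n : (n - m.+1 < n)%N by lia.
have [] := eoS _ lt_n; have /andP[] := d_le1 lt_n.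
have -> : ((n - m.+1).+1 = n - m)%N by lia.
have [] := IH (ltnW le_m) => he ho heo h1 h2 -> ->.
by split; rewrite /Num.min; repeat case: ifP => ?; lra.
Qed.

End ParityDistances.

Section ParityPolytope.
Context {R : realType}.
Variables (n : nat) (d : 'rV[R]_n) (D e o : nat -> R).
Hypothesis dP : parity_polytope d.
Hypothesis D_d : forall i : 'I_n, D i = d 0 i.

Lemma parity_polytope_le1 k : (k < n)%N -> -1 <= D k <= 1.
Proof.
move: dP => [m [w [v [w0 w1 vS dE]]]] lt_n.
rewrite (D_d (Ordinal lt_n)) dE summxE; apply/andP; split.
  rewrite -{1}w1 -sumrN; apply: ler_sum => j _; rewrite mxE -mulrN1.
  by apply: ler_wpM2l => //; case: (vS j) => /(_ (Ordinal lt_n)) [] ->; lra.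
rewrite -[leRHS]w1; apply: ler_sum => j _; rewrite mxE ler_piMr //.
by case: (vS j) => /(_ (Ordinal lt_n)) [] ->; lra.
Qed.

(** The weights w form a probability distribution on even vertices with mean d. Let P k be the
    expected product of the signs from position k on. Then 1 - P k and 1 + P k bound the two
    distances from below, and P 0 = 1 since all vertices are even. *)
Lemma parity_polytope_odd : parity_distances n D e o -> 2 <= o 0%N.
Proof.
move: dP => [m [w [v [w0 w1 vS dE]]]] [en on eoS].
pose q j k := \prod_(i < n | (k <= i)%N) v j 0 i.
have q_sign j k : q j k = 1 \/ q j k = -1.
  apply: (big_ind (fun x => x = 1 \/ x = -1)); first by left.
    by move=> x y [] -> [] ->; rewrite ?mulr1 ?mul1r ?mulrNN ?mulr1;
      [left | right | right | left].
  by move=> i _; case: (vS j).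
pose P k := \sum_j w j * q j k.
(* The expectation of the nonnegative product (1 + a v_k) (1 + b q_(k+1)), expanded with q_k = v_k
   q_(k+1). *)
have PS k (a b : R) : (k < n)%N -> a = 1 \/ a = -1 -> b = 1 \/ b = -1 ->
    0 <= 1 + a * D k + b * P k.+1 + a * b * P k.
  move=> lt_n a1 b1; pose i := Ordinal lt_n.
  have qS j : q j k = v j 0 i * q j k.+1.
    rewrite /q (bigD1 i) //=; congr (_ * _); apply: eq_bigl => l.
    by rewrite -(inj_eq val_inj) /= ltn_neqAle [k == l]eq_sym andbC.
  have -> : 1 + a * D k + b * P k.+1 + a * b * P k =
      \sum_j w j * ((1 + a * v j 0 i) * (1 + b * q j k.+1)).
    rewrite (D_d i) dE summxE -{1}w1 !mulr_sumr -!big_split /=.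
    by apply: eq_bigr => j _; rewrite mxE qS; ring.
  apply: sumr_ge0 => j _; rewrite mulr_ge0 //.
  case: (vS j) => /(_ i) v_sign _.
  by apply: mulr_ge0; [case: v_sign | case: (q_sign j k.+1)] => ->;
    [case: a1 | case: a1 | case: b1 | case: b1] => ->; lra.
(* Descending induction; the four choices of signs in [PS] match the four branches of the two
   minima. *)
have eoP k : (k <= n)%N -> 1 - P k <= e k /\ 1 + P k <= o k.
  move=> /subKn <-; elim: (n - k)%N (leq_subr k n) => [|l IH] le_l.
    have Pn : P n = 1.
      rewrite -w1; apply: eq_bigr => j _; rewrite /q big1 ?mulr1 // => i.
      by rewrite leqNgt ltn_ord.
    by rewrite subn0 en on Pn; split; lra.
  have lt_n : (n - l.+1 < n)%N by lia.
  have [] := eoS _ lt_n; move: (fun a b => PS _ a b lt_n) (IH (ltnW le_l)).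
  have -> : ((n - l.+1).+1 = n - l)%N by lia.
  move=> PS' [he ho] -> ->.
  have h11 := PS' 1 1 (or_introl erefl) (or_introl erefl).
  have h1N := PS' 1 (-1) (or_introl erefl) (or_intror erefl).
  have hN1 := PS' (-1) 1 (or_intror erefl) (or_introl erefl).
  have hNN := PS' (-1) (-1) (or_intror erefl) (or_intror erefl).
  by rewrite !le_min; split; apply/andP; split; lra.
have P0 : P 0%N = 1.
  by rewrite -w1; apply: eq_bigr => j _; rewrite /q; case: (vS j) => _ ->; rewrite mulr1.
by have [_] := eoP _ (leq0n n); rewrite P0; lra.
Qed.

End ParityPolytope.

(** * One step of the induction: the next diagonal entry and the angles *)

(** The bounds 1 - e <= x <= o - 1 keep x followed by the remaining suffix at distance at least 2
    from the odd vectors. The chosen x is the least one with |a + b| <= 1 + x and 1 - e <= x;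
    splitting the minima gives |a - b| <= e and |a + b| <= o, from which the upper bounds on x
    follow. The form 0 - (a + b) - 1 is the one that the program evaluates, as [rexp] has no
    negation. *)
Lemma next_diagonal {R : realType} (a b e o x : R) :
  -1 <= a <= 1 -> -1 <= b <= 1 -> 0 <= o -> 2 <= e + o ->
  1 - Num.min (e + (1 - b)) (o + (1 + b)) <= a ->
  a <= Num.min (o + (1 - b)) (e + (1 + b)) - 1 ->
  x = Num.max (Num.max (a + b - 1) (0 - (a + b) - 1)) (1 - e) ->
  [/\ -1 <= x <= 1, 1 - e <= x <= o - 1,
      -(1 + x) <= a + b <= 1 + x & -(1 - x) <= a - b <= 1 - x].
Proof.
move=> ha hb ho heo h1 h2 ->.
have [] : 1 - (e + (1 - b)) <= a /\ 1 - (o + (1 + b)) <= a.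
  by move: h1; rewrite /Num.min; case: ifP => [|/negbT]; rewrite -?leNgt => ?; split; lra.
have [] : a <= o + (1 - b) - 1 /\ a <= e + (1 + b) - 1.
  by move: h2; rewrite /Num.min; case: ifP => [|/negbT]; rewrite -?leNgt => ?; split; lra.
move=> *; rewrite /Num.max.
by repeat case: ifP => [|/negbT]; rewrite -?leNgt => ?; split; lra.
Qed.

(* With u = cos (2 alpha) and v = cos (2 beta), the rotations by alpha + beta and
   beta - alpha turn diag(1, x) into a matrix of diagonal (a, b). *)
Lemma half_angle {R : realType} (u v x a b ca sa cb sb c1 s1 c2 s2 : R) :
  -1 <= u <= 1 -> -1 <= v <= 1 ->
  (1 + x) * u = a + b -> (1 - x) * v = a - b ->
  ca = Num.sqrt ((1 + u) / (1 + 1)) -> sa = Num.sqrt ((1 - u) / (1 + 1)) ->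
  cb = Num.sqrt ((1 + v) / (1 + 1)) -> sb = Num.sqrt ((1 - v) / (1 + 1)) ->
  c1 = ca * cb - sa * sb -> s1 = sa * cb + ca * sb ->
  c2 = ca * cb + sa * sb -> s2 = ca * sb - sa * cb ->
  [/\ c1 ^+ 2 + s1 ^+ 2 = 1, c2 ^+ 2 + s2 ^+ 2 = 1,
      c1 * c2 + s1 * s2 * x = a & s1 * s2 + c1 * c2 * x = b].
Proof.
move=> hu hv eu ev Eca Esa Ecb Esb -> -> -> ->.
have ca2 : ca ^+ 2 = (1 + u) / (1 + 1) by rewrite Eca sqr_sqrtr // divr_ge0 //; lra.
have sa2 : sa ^+ 2 = (1 - u) / (1 + 1) by rewrite Esa sqr_sqrtr // divr_ge0 //; lra.
have cb2 : cb ^+ 2 = (1 + v) / (1 + 1) by rewrite Ecb sqr_sqrtr // divr_ge0 //; lra.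
have sb2 : sb ^+ 2 = (1 - v) / (1 + 1) by rewrite Esb sqr_sqrtr // divr_ge0 //; lra.
(* Only squares of the half-angle values survive in the products needed, so all four roots may be
   taken nonnegative. *)
have pE : (ca * cb - sa * sb) * (ca * cb + sa * sb) = (u + v) / 2.
  transitivity (ca ^+ 2 * cb ^+ 2 - sa ^+ 2 * sb ^+ 2); first by ring.
  by rewrite ca2 sa2 cb2 sb2; field.
have qE : (sa * cb + ca * sb) * (ca * sb - sa * cb) = (u - v) / 2.
  transitivity (ca ^+ 2 * sb ^+ 2 - sa ^+ 2 * cb ^+ 2); first by ring.
  by rewrite ca2 sa2 cb2 sb2; field.
split.
- transitivity ((ca ^+ 2 + sa ^+ 2) * (cb ^+ 2 + sb ^+ 2)); first by ring.
  by rewrite ca2 sa2 cb2 sb2; field.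
- transitivity ((ca ^+ 2 + sa ^+ 2) * (cb ^+ 2 + sb ^+ 2)); first by ring.
  by rewrite ca2 sa2 cb2 sb2; field.
- by rewrite pE qE; lra.
- by rewrite pE qE; lra.
Qed.

(** * The program *)

Definition dim_reg := IVar 0.
Definition row_reg := IVar 1.
Definition col_reg := IVar 2.
Definition zero := ICst 0.
Definition one := ICst 1.
Definition next i := IAdd i one.

(* Array 0 holds the input, array 1 the matrix under construction, array 2 the
   distances of the suffixes to the even and odd sign vectors, array 3 the diagonal
   entries x chosen by the induction. *)
Definition diag_cell i := RCell 0 i zero.
Definition mx_cell i j := RCell 1 i j.
Definition even_cell i := RCell 2 i zero.
Definition odd_cell i := RCell 2 i one.
Definition pivot_cell i := RCell 3 i zero.
Definition scalar m := RCell 4 (ICst m) zero.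
Definition set_scalar m e := RSet 4 (ICst m) zero e.

(* Used only for [|e1| <= e2]: when e2 vanishes, so does e1, and any value in
   [-1, 1] serves as quotient. *)
Definition set_ratio m e1 e2 :=
  If (RLe e2 RZero) (set_scalar m ROne) (set_scalar m (RDiv e1 e2)).

(** A backward pass. For the empty suffix only the odd distance is written; the even one is the 0
    already stored. *)
Definition parity_distances_code :=
  Seq (RSet 2 dim_reg one (RAdd ROne ROne))
  (Seq (ISet 1 dim_reg)
  (While (ILt zero row_reg)
    (Seq (ISet 1 (ISub row_reg one))
    (Seq (set_min 2 row_reg zero
           (RAdd (even_cell (next row_reg)) (RSub ROne (diag_cell row_reg)))
           (RAdd (odd_cell (next row_reg)) (RAdd ROne (diag_cell row_reg))))
    (set_min 2 row_reg one
           (RAdd (odd_cell (next row_reg)) (RSub ROne (diag_cell row_reg)))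
           (RAdd (even_cell (next row_reg)) (RAdd ROne (diag_cell row_reg)))))))).

(** A forward pass, which also turns the zero array 1 into the identity by writing its diagonal. It
    leaves [row_reg] at n - 1, where the rotations start. *)
Definition pivots_code :=
  Seq (RSet 3 zero zero (diag_cell zero))
  (Seq (RSet 1 zero zero ROne)
  (Seq (ISet 1 zero)
  (While (ILt (next row_reg) dim_reg)
    (Seq (set_max 3 (next row_reg) zero
           (RSub (RAdd (pivot_cell row_reg) (diag_cell (next row_reg))) ROne)
           (RSub (RSub RZero (RAdd (pivot_cell row_reg) (diag_cell (next row_reg)))) ROne))
    (Seq (set_max 3 (next row_reg) zero
           (pivot_cell (next row_reg)) (RSub ROne (even_cell (next (next row_reg)))))
    (Seq (ISet 1 (next row_reg))
    (RSet 1 row_reg row_reg ROne))))))).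

(** Scalars 4 and 5 hold the double-angle cosines u and v, scalars 6 to 9 the half-angle values; 0,
    1 and 2, 3 receive cosine and sine of the row and column rotations. *)
Definition angles_code :=
  let a := pivot_cell row_reg in
  let b := diag_cell (next row_reg) in
  let x := pivot_cell (next row_reg) in
  let two := RAdd ROne ROne in
  let ca := scalar 6 in let sa := scalar 7 in
  let cb := scalar 8 in let sb := scalar 9 in
  Seq (set_ratio 4 (RAdd a b) (RAdd ROne x))
  (Seq (set_ratio 5 (RSub a b) (RSub ROne x))
  (Seq (set_scalar 6 (RSqrt (RDiv (RAdd ROne (scalar 4)) two)))
  (Seq (set_scalar 7 (RSqrt (RDiv (RSub ROne (scalar 4)) two)))
  (Seq (set_scalar 8 (RSqrt (RDiv (RAdd ROne (scalar 5)) two)))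
  (Seq (set_scalar 9 (RSqrt (RDiv (RSub ROne (scalar 5)) two)))
  (Seq (set_scalar 0 (RSub (RMul ca cb) (RMul sa sb)))
  (Seq (set_scalar 1 (RAdd (RMul sa cb) (RMul ca sb)))
  (Seq (set_scalar 2 (RAdd (RMul ca cb) (RMul sa sb)))
  (set_scalar 3 (RSub (RMul ca sb) (RMul sa cb))))))))))).

(* With [tr], the rotation acts on the transpose, hence on columns. *)
Definition line_cell (tr : bool) i j := if tr then mx_cell j i else mx_cell i j.
Definition set_line (tr : bool) i j e := if tr then RSet 1 j i e else RSet 1 i j e.

(** Scalar 4, free again once the angles are known, saves the first entry of each pair before it is
    overwritten. *)
Definition rotate_code (tr : bool) c s :=
  Seq (ISet 2 zero)
  (While (ILt col_reg dim_reg)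
    (Seq (set_scalar 4 (line_cell tr row_reg col_reg))
    (Seq (set_line tr row_reg col_reg
           (RSub (RMul (scalar c) (scalar 4))
                 (RMul (scalar s) (line_cell tr (next row_reg) col_reg))))
    (Seq (set_line tr (next row_reg) col_reg
           (RAdd (RMul (scalar s) (scalar 4))
                 (RMul (scalar c) (line_cell tr (next row_reg) col_reg))))
    (ISet 2 (next col_reg)))))).

Definition rotations_code :=
  While (ILt zero row_reg)
    (Seq (ISet 1 (ISub row_reg one))
    (Seq angles_code
    (Seq (rotate_code false 0 1)
    (rotate_code true 2 3)))).

Definition diagonal_code :=
  Seq parity_distances_code (Seq pivots_code rotations_code).

(** * Correctness and cost of the program *)

Section Correctness.
Context {R : realType}.
Implicit Types s : state R.

Lemma parity_distances_codeP n s :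
  idx s 0 = n -> cell s 2 n 0 = 0 ->
  runs parity_distances_code s (200 * n.+1)
    (fun s' => [/\ idx s' 0 = n, cell s' 0 = cell s 0, cell s' 1 = cell s 1 &
       parity_distances n (fun i => cell s 0 i 0) (fun i => cell s' 2 i 0)
                          (fun i => cell s' 2 i 1)]).
Proof.
move=> s0 s2.
pose I m s' := [/\ (m <= n)%N, idx s' 0 = n, idx s' 1 = m, cell s' 0 = cell s 0 &
  cell s' 1 = cell s 1] /\ [/\ cell s' 2 n 0 = 0, cell s' 2 n 1 = 1 + 1 &
  forall k, (m <= k < n)%N ->
    cell s' 2 k 0 = Num.min (cell s' 2 k.+1 0 + (1 - cell s 0 k 0))
                            (cell s' 2 k.+1 1 + (1 + cell s 0 k 0)) /\
    cell s' 2 k 1 = Num.min (cell s' 2 k.+1 1 + (1 - cell s 0 k 0))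
                            (cell s' 2 k.+1 0 + (1 + cell s 0 k 0))].
apply: (@runs_weaken _ _ _ _ _ (I 0%N)); last first.
- apply: runs_seq; apply: runs_rset; first by [].
  apply: runs_seq; apply: runs_iset.
  apply: (runs_while (m := n)).
  + move=> m s'; rewrite /I => -[[le_m r0 r1 c0 c1] [en on eoS]]; split.
      by rewrite /= r1.
    apply: runs_seq; apply: runs_iset.
    apply: runs_seq; apply: runs_min; [by [] | by [] |].
    apply: runs_min; [by [] | by [] |].
    rewrite /= r1 r0 subn1 addn1 /=.
    split; first by split => //; exact: ltnW.
    have nm : (n == m) = false by lia.
    have mm : (m.+1 == m) = false by lia.
    rewrite !nm !mm /= en on; split=> // k /andP[mk kn].
    have km : (k.+1 == m) = false by lia.
    rewrite !km /= c0 !andbF !andbT; have [->//|km'] := eqVneq k m.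
    by apply: eoS; rewrite ltn_neqAle [m == k]eq_sym km' mk.
  + by move=> s' [[_ _ r1 _ _] _] /=; rewrite r1.
  + rewrite /I /= s0; split; split; rewrite ?eqxx //.
    by move=> k /andP[]; rewrite leqNgt => /negbTE ->.
- move=> s' [[_ -> _ -> ->] [en on eoS]].
  by split.
- by rewrite /opt_cost /=; lia.
Qed.

(** The invariant 1 - e (r + 1) <= x r <= o (r + 1) - 1 is propagated by [next_diagonal]. At r = n -
    1 the suffix is empty, and the values 0 and 2 force the last pivot to be 1, the only element of
    SO(1). *)
Lemma pivots_codeP n s :
  (0 < n)%N -> idx s 0 = n ->
  (forall i j, cell s 1 i j = 0) ->
  let d i := cell s 0 i 0 in
  let e i := cell s 2 i 0 in
  let o i := cell s 2 i 1 in
  (forall i, (i < n)%N -> -1 <= d i <= 1) ->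
  parity_distances n d e o -> 2 <= o 0%N ->
  runs pivots_code s (200 * n.+1)
    (fun s' => let x i := cell s' 3 i 0 in
     [/\ idx s' 0 = n, idx s' 1 = n.-1, cell s' 0 = cell s 0,
         forall i j, (i < n)%N -> cell s' 1 i j = (i == j)%:R &
       [/\ x 0%N = d 0%N, x n.-1 = 1 & forall k, (k.+1 < n)%N ->
         -(1 + x k.+1) <= x k + d k.+1 <= 1 + x k.+1 /\
         -(1 - x k.+1) <= x k - d k.+1 <= 1 - x k.+1]]).
Proof.
move=> n0 s0 s1 d e o d_le1 eoP o0.
have eo_ge := parity_distances_ge eoP d_le1.
have [en on eoS] := eoP.
pose I m s' := let x i := cell s' 3 i 0 in
  let r := idx s' 1 in
  [/\ (r + m).+1 = n, idx s' 0 = n, cell s' 0 = cell s 0, cell s' 2 = cell s 2 &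
   forall i j, cell s' 1 i j = ((i == j) && (i <= r)%N)%:R] /\
  [/\ x 0%N = d 0%N, -1 <= x r <= 1, 1 - e r.+1 <= x r <= o r.+1 - 1 &
   forall k, (k < r)%N ->
         -(1 + x k.+1) <= x k + d k.+1 <= 1 + x k.+1 /\
         -(1 - x k.+1) <= x k - d k.+1 <= 1 - x k.+1].
apply: (@runs_weaken _ _ _ _ _ (I 0%N)); last first.
- apply: runs_seq; apply: runs_rset; first by [].
  apply: runs_seq; apply: runs_rset; first by [].
  apply: runs_seq; apply: runs_iset.
  apply: (runs_while (m := n.-1)).
  + move=> m s' [/= [rm r0 c0 c2 c1] [x0 x1 xeo xS]]; split.
      by rewrite r0; congr Some; lia.
    apply: runs_seq; apply: runs_max; [by [] | by [] |].
    apply: runs_seq; apply: runs_max; [by [] | by [] |].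
    apply: runs_seq; apply: runs_iset.
    apply: runs_rset; first by [].
    rewrite /I /= !addn1 !eqxx /= r0 c0 c2.
    move: (idx s' 1) rm x1 xeo xS c1 => r rm x1 xeo xS c1.
    have r1n : (r.+1 < n)%N by lia.
    (* Unfolding the recurrence once brings the invariant into the form that [next_diagonal]
       expects. *)
    have [ee oo] := eoS _ r1n; rewrite ee oo in xeo.
    have [_ ho heo] := eo_ge _ r1n.
    have /andP[xe xo] := xeo.
    have [y1 yeo ya yb] :=
      next_diagonal x1 (d_le1 _ r1n) ho heo xe xo (erefl _).
    split; split=> //; first by rewrite -rm addnS.
      move=> i j; rewrite c1; have [->|ir] := eqVneq i r.+1.
        by rewrite ltnn andbF leqnn andbT eq_sym; case: eqP.
      by rewrite /= [(i <= r.+1)%N]leq_eqVlt (negbTE ir).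
    move=> k; rewrite ltnS leq_eqVlt eqSS => /orP[/eqP ->|kr].
      by rewrite eqxx (ltn_eqF (ltnSn r)).
    by rewrite (ltn_eqF kr) (ltn_eqF (leqW kr)); exact: xS.
  + by move=> s' [/= [rm r0 _ _ _] _]; rewrite r0; congr Some; lia.
  (* For x 0 = d 0 the invariant is 2 <= o 0 with the minimum split. *)
  + rewrite /I /=; have [_ o0E] := eoS _ n0.
    have := d_le1 _ n0; move: o0; rewrite o0E le_min => /andP[h1 h2] hd.
    split; split => //; first by rewrite add0n prednK.
      by move=> i j; rewrite s1; case: i => [|i]; case: j => [|j] //=; rewrite ?andbF.
    by rewrite -/(d 0%N) -/(e 1%N) -/(o 1%N); apply/andP; split; lra.
- move=> s' [/= [rm r0 c0 c2 c1] [x0 x1 xeo xS]].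
  have rn : n.-1 = idx s' 1 by lia.
  split; rewrite ?rn //.
    by move=> i j lt_in; rewrite c1; congr (_%:R); lia.
  split=> //; last by move=> k kn; apply: xS; lia.
  by move: xeo; rewrite -rn prednK // en on; lra.
- by rewrite /opt_cost /=; lia.
Qed.

Definition same_but_scalars s s' :=
  idx s' = idx s /\ forall a, a != 4%N -> cell s' a = cell s a.

(** The new state is known only through a frame condition and a lookup rule, which keeps long chains
    of assignments free of nested updates. *)
Lemma runs_scalar m e v s Q :
  reval s e = Some v ->
  (forall s', same_but_scalars s s' ->
     (forall l, cell s' 4 l 0 = if l == m then v else cell s 4 l 0) -> Q s') ->
  runs (set_scalar m e) s (rcost e + 3) Q.
Proof.
move=> ev QP; apply: runs_le; last first.
- apply: (runs_rset ev); apply: QP => [|l] /=; last by rewrite andbT.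
  by split=> // a /negbTE a4 /=; rewrite a4.
- by rewrite /=; lia.
Qed.

Lemma runs_ratio m e1 e2 a b s Q :
  reval s e1 = Some a -> reval s e2 = Some b -> - b <= a <= b ->
  (forall s' v, same_but_scalars s s' -> -1 <= v <= 1 -> b * v = a ->
     (forall l, cell s' 4 l 0 = if l == m then v else cell s 4 l 0) -> Q s') ->
  runs (set_ratio m e1 e2) s (rcost e1 + rcost e2 + rcost e2 + 7) Q.
Proof.
move=> ev1 ev2 ab QP; apply: runs_le; last first.
- apply: (runs_if (v := b <= 0)); first by rewrite /= ev2.
    move=> b0; apply: (runs_scalar (v := 1)) => // s' ss' s'E.
    by apply: QP ss' _ _ s'E; lra.
  rewrite -ltNge => b0; have b_neq0 := lt0r_neq0 b0.
  apply: (runs_scalar (v := a / b)).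
    by rewrite /= ev1 ev2 (negbTE b_neq0).
  move=> s' ss' s'E; apply: QP ss' _ _ s'E; last by rewrite mulrC divfK.
  by rewrite ler_pdivlMr // ler_pdivrMr // mulN1r mul1r.
- by rewrite /=; lia.
Qed.

Lemma angles_codeP r s :
  idx s 1 = r ->
  let a := cell s 3 r 0 in
  let b := cell s 0 r.+1 0 in
  let x := cell s 3 r.+1 0 in
  -(1 + x) <= a + b <= 1 + x -> -(1 - x) <= a - b <= 1 - x ->
  runs angles_code s 300 (fun s' => same_but_scalars s s' /\
    let c m := cell s' 4 m 0 in
    [/\ c 0%N ^+ 2 + c 1%N ^+ 2 = 1, c 2%N ^+ 2 + c 3%N ^+ 2 = 1,
        c 0%N * c 2%N + c 1%N * c 3%N * x = a & c 1%N * c 3%N + c 0%N * c 2%N * x = b]).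
Proof.
move=> s1 a b x habp habm.
(* These facts exclude the error cases of division and square root. *)
have half_ge0 (y : R) : -1 <= y <= 1 ->
    (1 + 1 == 0 :> R) = false /\ 0 <= (1 + y) / (1 + 1) /\ 0 <= (1 - y) / (1 + 1).
  move=> hy; split; first by apply/negbTE; rewrite lt0r_neq0 //; lra.
  by split; rewrite divr_ge0 //; lra.
rewrite /angles_code; apply: runs_le; last first.
- apply: runs_seq; eapply runs_ratio; [by [] | by [] | by rewrite /= s1 addn1 |].
  move=> s2 u [i2 c2] u1 uE h2.
  apply: runs_seq.
  eapply runs_ratio; [by [] | by [] | by rewrite /= i2 !c2 // s1 addn1 |].
  move=> s3 v [i3 c3] v1 vE h3.
  rewrite /= s1 addn1 -/a -/b -/x in uE; rewrite /= i2 !c2 // s1 addn1 -/a -/b -/x in vE.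
  have u3 : cell s3 4 4 0 = u by rewrite h3 /= h2.
  have v3 : cell s3 4 5 0 = v by rewrite h3.
  have [two [up um]] := half_ge0 _ u1; have [_ [vp vm]] := half_ge0 _ v1.
  apply: runs_seq; apply: runs_scalar => [|s4 [i4 c4] h4].
    by rewrite /= u3 two up.
  apply: runs_seq; apply: runs_scalar => [|s5 [i5 c5] h5].
    by rewrite /= h4 /= u3 two um.
  apply: runs_seq; apply: runs_scalar => [|s6 [i6 c6] h6].
    by rewrite /= h5 /= h4 /= v3 two vp.
  apply: runs_seq; apply: runs_scalar => [|s7 [i7 c7] h7].
    by rewrite /= h6 /= h5 /= h4 /= v3 two vm.
  apply: runs_seq; apply: runs_scalar => [|s8 [i8 c8] h8]; first by [].
  apply: runs_seq; apply: runs_scalar => [|s9 [i9 c9] h9]; first by [].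
  apply: runs_seq; apply: runs_scalar => [|s10 [i10 c10] h10]; first by [].
  apply: runs_scalar => [|s11 [i11 c11] h11]; first by [].
  split.
    split; first by rewrite i11 i10 i9 i8 i7 i6 i5 i4 i3 i2.
    by move=> k k4; rewrite c11 // c10 // c9 // c8 // c7 // c6 // c5 // c4 // c3 // c2.
  apply: (half_angle u1 v1 uE vE (ca := cell s7 4 6 0) (sa := cell s7 4 7 0)
    (cb := cell s7 4 8 0) (sb := cell s7 4 9 0));
  by rewrite ?h11 /= ?h10 /= ?h9 /= ?h8 /= ?h7 /= ?h6 /= ?h5 /= ?h4.
- by rewrite /=; lia.
Qed.
Definition line s (tr : bool) i j := if tr then cell s 1 j i else cell s 1 i j.

(** The entries of [mul_givensE] for q = p + 1, on an array indexed by all naturals. *)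
Definition rotated p (c sn : R) (A : nat -> nat -> R) i j :=
  if i == p then c * A p j - sn * A p.+1 j
  else if i == p.+1 then sn * A p j + c * A p.+1 j else A i j.

Lemma runs_set_line tr i j e v s Q :
  reval s e = Some v ->
  (forall s', idx s' = idx s -> (forall a, a != 1%N -> cell s' a = cell s a) ->
     (forall k l, line s' tr k l =
        if (k == ieval (idx s) i) && (l == ieval (idx s) j) then v else line s tr k l) ->
     Q s') ->
  runs (set_line tr i j e) s (icost i + icost j + rcost e).+1 Q.
Proof.
rewrite /set_line; case: tr => ev QP.
  rewrite [(icost i + _)%N]addnC; apply: (runs_rset ev); apply: QP => //.
    by move=> a /negbTE a1 /=; rewrite a1.
  by move=> k l; rewrite /line /= andbC.
apply: (runs_rset ev); apply: QP => //.
by move=> a /negbTE a1 /=; rewrite a1.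
Qed.

Lemma reval_line_cell tr i j s :
  reval s (line_cell tr i j) = Some (line s tr (ieval (idx s) i) (ieval (idx s) j)).
Proof. by case: tr. Qed.

(** The coefficients must avoid scalar 4, the temporary of the loop. The invariant says that exactly
    the positions below [col_reg] are rotated. *)
Lemma rotate_codeP n p tr mc ms s :
  idx s 0 = n -> idx s 1 = p -> mc != 4%N -> ms != 4%N ->
  runs (rotate_code tr mc ms) s (100 * n.+1) (fun s' =>
    [/\ idx s' 0 = n, idx s' 1 = p,
        forall a, a != 1%N -> a != 4%N -> cell s' a = cell s a,
        forall m, m != 4%N -> cell s' 4 m 0 = cell s 4 m 0 &
        forall i j, (j < n)%N -> line s' tr i j =
          rotated p (cell s 4 mc 0) (cell s 4 ms 0) (line s tr) i j]).
Proof.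
move=> s0 s1 /negbTE mc4 /negbTE ms4.
pose c := cell s 4 mc 0; pose sn := cell s 4 ms 0.
pose I m s' := [/\ idx s' 0 = n, idx s' 1 = p,
    forall a, a != 1%N -> a != 4%N -> cell s' a = cell s a &
    forall m, m != 4%N -> cell s' 4 m 0 = cell s 4 m 0] /\
  [/\ (idx s' 2 + m)%N = n & forall i j, line s' tr i j =
    if (j < idx s' 2)%N then rotated p c sn (line s tr) i j else line s tr i j].
apply: (@runs_weaken _ _ _ _ _ (I 0%N)); last first.
- apply: runs_seq; apply: runs_iset.
  apply: (runs_while (m := n)).
  + move=> m t [[t0 t1 tc ts] [t2 tl]]; split.
      by rewrite /= t0 -t2 addnS ltnS leq_addr.
    apply: runs_seq; apply: runs_scalar => [|u [ui uc] us].
      by rewrite reval_line_cell.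
    have ul i j : line u tr i j = line t tr i j by rewrite /line uc.
    apply: runs_seq; apply: runs_set_line => [|v vi vc vl].
      by rewrite /= reval_line_cell.
    apply: runs_seq; apply: runs_set_line => [|w wi wc wl].
      by rewrite /= reval_line_cell.
    apply: runs_iset.
    have k4 a : cell w 4 a 0 = if a == 4%N then line t tr p (idx t 2) else cell s 4 a 0.
      by rewrite wc // vc // us /= t1; case: eqP => // /eqP; exact: ts.
    have p1 : (p.+1 == p) = false by lia.
    (* When entry p + 1 is computed, entry p is already new: its old value comes from scalar 4. *)
    have wE i j : line w tr i j = if j == idx t 2 then rotated p c sn (line t tr) i j
                                  else line t tr i j.
      rewrite wl vl ?ul /= vi ui t1 addn1 /= ?ul.
      rewrite vl /= ui t1 addn1 p1 !us /= mc4 ms4 !ts ?mc4 ?ms4 // -/c -/sn ?ul.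
      rewrite !vc // !us /= mc4 ms4 !ts ?mc4 ?ms4 // -/c -/sn t1 /rotated.
      have [->|_] := eqVneq j (idx t 2); last by rewrite !andbF.
      by rewrite !andbT; have [->|ip] := eqVneq i p; rewrite // [p == _]eq_sym p1.
    rewrite /I /= wi vi ui addn1; split; split => //.
    - by move=> a a1 a4; rewrite wc // vc // uc // tc.
    - by move=> a /negbTE a4; rewrite k4 a4.
    - by rewrite -t2 addnS.
    - move=> i j; rewrite -[LHS]/(line w tr i j) wE ltnS leq_eqVlt.
      have [->|jk] /= := eqVneq j (idx t 2); last by rewrite tl.
      by rewrite /rotated !tl ltnn.
  + by move=> t [[t0 _ _ _] [t2 _]] /=; rewrite t0 -t2 addn0 ltnn.
  + by split; split => //; rewrite /= add0n.
- move=> t [[t0 t1 tc ts] [t2 tl]]; split => // i j jn.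
  by rewrite tl -t2 addn0 in jn *; rewrite jn.
- by case: (tr); rewrite /=; lia.
Qed.
(** The block form 1 (+) X', with an identity block of order k. *)
Definition agree_with_1 (n : nat) (k : nat) (M : 'M[R]_n) :=
  forall i j : 'I_n, (i < k)%N || (j < k)%N -> M i j = (i == j)%:R.

(** The block of M on p and q is diag(1, x), which the rotations turn into one of diagonal (a, b).
    Indices below p stay in the identity block, and diagonal entries beyond q do not move. *)
Lemma rotated_step n (M : 'M[R]_n) (p q : 'I_n) (a b x c1 s1 c2 s2 : R) :
  q = p.+1 :> nat -> special_orthogonal M -> agree_with_1 q M -> M q q = x ->
  c1 ^+ 2 + s1 ^+ 2 = 1 -> c2 ^+ 2 + s2 ^+ 2 = 1 ->
  c1 * c2 + s1 * s2 * x = a -> s1 * s2 + c1 * c2 * x = b ->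
  let M' := givens p q c1 s1 *m M *m (givens p q c2 s2)^T in
  [/\ special_orthogonal M', agree_with_1 p M', M' p p = a, M' q q = b &
      forall i : 'I_n, (q < i)%N -> M' i i = M i i].
Proof.
move=> qp MSO M1 Mqq cs1 cs2 aE bE M'.
have pq : p != q by rewrite -val_eqE /= qp; lia.
have qp' : (q == p) = false by rewrite eq_sym (negbTE pq).
have M'E i j : M' i j =
    if j == p then c2 * (givens p q c1 s1 *m M) i p - s2 * (givens p q c1 s1 *m M) i q
    else if j == q then s2 * (givens p q c1 s1 *m M) i p + c2 * (givens p q c1 s1 *m M) i q
    else (givens p q c1 s1 *m M) i j by rewrite mul_tr_givensE.
have Mpp : M p p = 1 by rewrite M1 ?eqxx // qp ltnSn.
have Mpq : M p q = 0 by rewrite M1 ?(negbTE pq) // qp ltnSn.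
have Mqp : M q p = 0 by rewrite M1 ?qp' // qp ltnSn orbT.
split.
- apply: special_orthogonalM.
    by apply: special_orthogonalM => //; exact: givens_orthogonal.
  by apply: special_orthogonal_tr; exact: givens_orthogonal.
- move=> i j ij.
  have M1' (k l : 'I_n) : (k < p)%N || (l < p)%N -> M k l = (k == l)%:R.
    by move=> kl; apply: M1; rewrite qp; lia.
  rewrite M'E !mul_givensE.
  have [ip|ip] := ltnP i p.
    have [ip' iq'] : (i == p) = false /\ (i == q) = false.
      by split; rewrite -val_eqE /=; lia.
    rewrite ip' iq' !M1' ?ip // ip' iq' /=.
    have [->|_] := eqVneq j p; first by rewrite ip' /=; ring.
    by have [->|_] := eqVneq j q; first by rewrite iq' /=; ring.
  have jp : (j < p)%N by move: ij; rewrite ltnNge ip.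
  have [jp' jq'] : (p == j) = false /\ (q == j) = false.
    by split; rewrite -val_eqE /=; lia.
  rewrite ![j == _]eq_sym jp' jq' !M1' ?jp ?orbT // jp' jq' /=.
  have [->|_] := eqVneq i p; first by rewrite jp' /=; ring.
  by have [->|_] := eqVneq i q; first by rewrite jq' /=; ring.
- by rewrite M'E eqxx !mul_givensE eqxx Mpp Mpq Mqp Mqq -aE; ring.
- by rewrite M'E qp' eqxx !mul_givensE qp' eqxx Mpp Mpq Mqp Mqq -bE; ring.
- move=> i qi; have [ip iq] : (i == p) = false /\ (i == q) = false.
    by split; rewrite -val_eqE /=; lia.
  by rewrite M'E ip iq mul_givensE ip iq.
Qed.

Lemma output_rotated n s s' (p q : 'I_n) c sn tr :
  q = p.+1 :> nat ->
  (forall i j, (j < n)%N -> line s' tr i j = rotated p c sn (line s tr) i j) ->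
  output n s' = if tr then output n s *m (givens p q c sn)^T
                else givens p q c sn *m output n s.
Proof.
move=> qp s'E; apply/matrixP => i j; case: tr s'E => s'E.
  rewrite mul_tr_givensE !mxE; have := s'E j i (ltn_ord i); rewrite /line => ->.
  by rewrite /rotated -qp !val_eqE.
rewrite mul_givensE !mxE; have := s'E i j (ltn_ord j); rewrite /line => ->.
by rewrite /rotated -qp !val_eqE.
Qed.

Lemma rotations_codeP n s :
  (0 < n)%N -> idx s 0 = n -> idx s 1 = n.-1 -> output n s = 1%:M ->
  let d i := cell s 0 i 0 in
  let x i := cell s 3 i 0 in
  x n.-1 = 1 ->
  (forall k, (k.+1 < n)%N ->
     -(1 + x k.+1) <= x k + d k.+1 <= 1 + x k.+1 /\
     -(1 - x k.+1) <= x k - d k.+1 <= 1 - x k.+1) ->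
  runs rotations_code s (1000 * n ^ 2) (fun s' =>
    special_orthogonal (output n s') /\
    forall i : 'I_n, output n s' i i = if i == 0%N :> nat then x 0%N else d i).
Proof.
move=> n0 s0 s1 sout d x xn xS.
(* At stage k the matrix is 1 (+) X' with X' of diagonal (x k, d (k+1), ..., d (n-1)). It starts as
   the identity at k = n - 1, since x (n-1) = 1. *)
pose I k t := [/\ (k < n)%N, idx t 1 = k, idx t 0 = n, cell t 0 = cell s 0 &
     cell t 3 = cell s 3] /\
  [/\ special_orthogonal (output n t), agree_with_1 k (output n t) &
      forall i : 'I_n, (k <= i)%N ->
        output n t i i = if i == k :> nat then x k else d i].
apply: (@runs_weaken _ _ _ _ _ (I 0%N)); last first.
- apply: (runs_while (m := n.-1)).
  + move=> k t [[kn t1 t0 tc0 tc3] [tSO tI tD]]; split; first by rewrite /= t1.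
    have [habp habm] := xS _ kn.
    apply: runs_seq; apply: runs_iset.
    apply: runs_seq.
    apply: (runs_weaken (leqnn _)); last first.
      apply: (angles_codeP (r := k)); first by rewrite /= t1 subn1.
        by rewrite /= tc0 tc3.
      by rewrite /= tc0 tc3.
    move=> u [[ui uc] /= [cs1 cs2 aE bE]].
    apply: runs_seq.
    apply: (runs_weaken (leqnn _)); last first.
      by apply: (rotate_codeP (n := n) (p := k)) => //; rewrite ui /= ?t0 ?t1 ?subn1.
    move=> v [v0 v1 vc vs vl].
    apply: (runs_weaken (leqnn _)); last first.
      by apply: (rotate_codeP (n := n) (p := k)) => //.
    move=> w [w0 w1 wc ws wl].
    pose p := Ordinal (ltnW kn); pose q := Ordinal kn.
    have vout := output_rotated (p := p) (q := q) erefl vl.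
    have wout := output_rotated (p := p) (q := q) erefl wl.
    have uout : output n u = output n t.
      by apply/matrixP => i j; rewrite !mxE uc.
    have tqq : output n t q q = x k.+1 by rewrite tD //= eqxx.
    rewrite /= tc0 tc3 in aE bE.
    have := rotated_step (p := p) (q := q) erefl tSO tI tqq cs1 cs2 aE bE.
    rewrite /= vout uout !vs // in wout; rewrite -wout => -[wSO wI wpp wqq wD].
    split.
      split => //; first exact: ltnW.
        by rewrite wc // vc // uc.
      by rewrite wc // vc // uc.
    split=> // i; rewrite leq_eqVlt => /orP[/eqP ki|].
      have -> : i = p by apply: val_inj.
      by rewrite eqxx.
    rewrite leq_eqVlt => /orP[/eqP ki|ki].
      have -> : i = q by apply: val_inj.
      by rewrite wqq /= gtn_eqF.
    rewrite wD // tD; last exact: ltnW.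
    by rewrite !gtn_eqF // ltnW.
  + by move=> t [[_ t1 _ _ _] _]; rewrite /= t1.
  + split; first by split => //; rewrite prednK.
    rewrite sout; split.
    * by split; rewrite ?trmx1 ?mul1mx ?det1.
    * by move=> i j _; rewrite mxE.
    * move=> i ni; rewrite mxE eqxx; case: eqP => [_|/eqP]; first by rewrite xn.
      by have := ltn_ord i; lia.
- move=> t [_ [tSO _ tD]]; split => // i; rewrite tD //.
- by rewrite -mulnn -(prednK n0) /=; nia.
Qed.

End Correctness.

Theorem theorem2 (R : realType) :
  exists (p : com) (C : nat),
    forall (n : nat) (d : 'rV[R]_n),
      (0 < n)%N -> parity_polytope d ->
      exists (t : nat) (s : state R),
        [/\ exec p (init d) t s,
            (t <= C * n ^ 2)%N,
            special_orthogonal (output n s) &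
            diag_vec (output n s) = d].
Proof.
(* The phases cost at most 200 (n + 1), 200 (n + 1) and 1000 n^2; since n >= 1, the sum is below
   2000 n^2. *)
exists diagonal_code, 2000%N => n d n0 dP.
pose D i := cell (init d) 0 i 0.
have D_d (i : 'I_n) : D i = d 0 i by rewrite /D /= valK.
suff : runs diagonal_code (init d) (2000 * n ^ 2) (fun s =>
    special_orthogonal (output n s) /\ diag_vec (output n s) = d).
  by move=> [t [s [E le_t [SO diag]]]]; exists t, s.
apply: runs_le; last first.
- apply: runs_seq; apply: (runs_weaken (leqnn _)); last exact: parity_distances_codeP.
  move=> s [s0 c0 c1 eoP].
  apply: runs_seq; apply: (runs_weaken (leqnn _)); last first.
    apply: (pivots_codeP n0 s0); rewrite ?c0 ?c1 //.
      exact: parity_polytope_le1 dP D_d.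
    exact: parity_polytope_odd dP D_d eoP.
  move=> u [u0 u1 uc0 uc1 [x0 xn xS]].
  apply: (runs_weaken (leqnn _)); last first.
    apply: (rotations_codeP n0 u0 u1 _ xn).
      by apply/matrixP => i j; rewrite !mxE uc1.
    by rewrite uc0.
  move=> t [tSO tD]; split => //; apply/rowP => i.
  rewrite mxE tD -D_d /D; case: eqP => [->|_]; last by rewrite uc0 c0.
  by rewrite x0 c0.
- by rewrite /= -mulnn -(prednK n0); nia.
Qed.
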